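(* Up to isomorphism, there are exactly sixteen simple left $D$-modules, pairwise non-isomorphic: four $1$-dimensional ones, namely $\Bbbk_{\chi^j}$ for $0\le j\le 3$, and twelve $2$-dimensional ones, namely $V_{i,j}$ for $(i,j)\in\Lambda$.
   Context: $\Bbbk$ is an algebraically closed field of characteristic zero, $\xi\in\Bbbk$ is a fixed primitive $4$-th root of unity and $\sqrt2$ a fixed square root of $2$. $\mathcal K$ is the $8$-dimensional Hopf algebra generated as an algebra by $a,b,c,d$ with relations $ab=\xi ba$, $ac=\xi ca$, $cb=bc=0$, $cd=\xi dc$, $bd=\xi db$, $ad=da$, $ad=1$, $b^2=c^2=0$, $a^2c=b$, $a^4=1$, and coproduct $\Delta(a)=a\otimes a+b\otimes c$, $\Delta(b)=a\otimes b+b\otimes d$, $\Delta(c)=c\otimes a+d\otimes c$, $\Delta(d)=c\otimes b+d\otimes d$. $D=D(\mathcal K^{\mathrm{cop}})$ is the Drinfeld double of $\mathcal K^{\mathrm{cop}}$; it has dimension $64$. As an algebra it is presented by generators $a,b,c,d,x,g$ subject to: the relations $ab=\xi ba$, $ac=\xi ca$, $cb=bc=0$, $cd=\xi dc$, $bd=\xi db$, $ad=da$, $ad=1$, $b^2=c^2=0$, $a^2c=b$, $a^4=1$ of $\mathcal K$ for $a,b,c,d$; $g^4=1$, $x^2=g^2-1$, $gx=-xg$; and $ag=ga$, $bg=-gb$, $cg=-gc$, $dg=gd$, $ax+\xi xa=\sqrt2\xi(b+gc)$, $bx-\xi xb=\sqrt2\xi(a-gd)$, $cx+\xi xc=\sqrt2\xi(d-ga)$,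 $dx-\xi xd=\sqrt2\xi(c+gb)$. For $0\le j\le3$, $\Bbbk_{\chi^j}$ is the $1$-dimensional $D$-module given by the character $\chi^j(a)=\xi^j$, $\chi^j(b)=\chi^j(c)=0$, $\chi^j(d)=\xi^{-j}$, $\chi^j(x)=0$, $\chi^j(g)=(-1)^j$. $\Lambda=\{(i,j)\in\mathbb Z_4\times\mathbb Z_4: 2i\ne j\}$. For $(i,j)\in\Lambda$, $V_{i,j}$ is the $2$-dimensional $D$-module on which, in a fixed basis, the generators act by $a\mapsto\begin{pmatrix}\xi^i&0\\0&\xi^{i+3}\end{pmatrix}$, $b\mapsto\begin{pmatrix}0&(-1)^i\\0&0\end{pmatrix}$, $c\mapsto\begin{pmatrix}0&1\\0&0\end{pmatrix}$, $d\mapsto\begin{pmatrix}\xi^{-i}&0\\0&\xi^{-i+1}\end{pmatrix}$, $g\mapsto\begin{pmatrix}\xi^j&0\\0&\xi^{j+2}\end{pmatrix}$, $x\mapsto\begin{pmatrix}0&\frac{\sqrt2}{2}\xi(\xi^i+\xi^{3i+j})\\ \sqrt2\xi(\xi^{3i}-\xi^{i+j})&0\end{pmatrix}$. *)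

(* Defs.v *)
From HB Require Import structures.
From Stdlib Require Import ClassicalEpsilon.
From mathcomp Require Import all_boot all_order all_algebra.
From mathcomp Require Import ring finmap monalg.

Set Implicit Arguments.
Unset Strict Implicit.
Unset Printing Implicit Defensive.

Import GRing.Theory.
Local Open Scope ring_scope.
Local Open Scope quotient_scope.

Variant gen := Ga | Gb | Gc | Gd | Gx | Gg.

Definition gen_code (u : gen) : nat :=
  match u with Ga => 0 | Gb => 1 | Gc => 2 | Gd => 3 | Gx => 4 | Gg => 5 end%N.
Definition gen_decode (n : nat) : option gen :=
  nth None [:: Some Ga; Some Gb; Some Gc; Some Gd; Some Gx; Some Gg] n.
Lemma gen_codeK : pcancel gen_code gen_decode. Proof. by case. Qed.
HB.instance Definition _ := Choice.copy gen (pcan_type gen_codeK).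

(* The elements lhs - rhs of A, for the defining relations lhs = rhs of D
   with the generators replaced by their values under f. *)
Definition D_relations (k : fieldType) (xi sqrt2 : k) (A : algType k)
    (f : gen -> A) : seq A :=
  let a := f Ga in let b := f Gb in let c := f Gc in
  let d := f Gd in let x := f Gx in let g := f Gg in
  [:: a * b - xi *: (b * a);
      a * c - xi *: (c * a);
      c * b;
      b * c;
      c * d - xi *: (d * c);
      b * d - xi *: (d * b);
      a * d - d * a;
      a * d - 1;
      b ^+ 2;
      c ^+ 2;
      a ^+ 2 * c - b;
      a ^+ 4 - 1;
      g ^+ 4 - 1;
      x ^+ 2 - (g ^+ 2 - 1);
      g * x + x * g;
      a * g - g * a;
      b * g + g * b;
      c * g + g * c;
      d * g - g * d;
      a * x + xi *: (x * a) - (sqrt2 * xi) *: (b + g * c);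
      b * x - xi *: (x * b) - (sqrt2 * xi) *: (a - g * d);
      c * x + xi *: (x * c) - (sqrt2 * xi) *: (d - g * a);
      d * x - xi *: (x * d) - (sqrt2 * xi) *: (c + g * b)].

Definition satisfies_D_relations (k : fieldType) (xi sqrt2 : k) (A : algType k)
  (f : gen -> A) := {in D_relations xi sqrt2 f, forall r, r = 0}.

Lemma eq_D_relations (k : fieldType) (xi sqrt2 : k) (A : algType k)
    (f h : gen -> A) :
  f =1 h -> D_relations xi sqrt2 f = D_relations xi sqrt2 h.
Proof. by move=> fh; rewrite /D_relations !fh. Qed.

Lemma D_relations_map (k : fieldType) (xi sqrt2 : k) (A B : algType k)
    (h : {lrmorphism A -> B}) (f : gen -> A) :
  map h (D_relations xi sqrt2 f) = D_relations xi sqrt2 (h \o f).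
Proof.
have hZ c p : h (c *: p) = c *: h p by rewrite linearZZ.
have hM p q : h (p * q) = h p * h q by rewrite rmorphM.
have hX p n : h (p ^+ n) = h p ^+ n by rewrite rmorphXn.
have hD p q : h (p + q) = h p + h q by rewrite rmorphD.
have hN p : h (- p) = - h p by rewrite rmorphN.
have h1 : h 1 = 1 by rewrite rmorph1.
by rewrite /D_relations /= !(hX, hD, hN, hZ, hM, h1).
Qed.

(* Free algebra k<a, b, c, d, x, g>: the monoid algebra of the free monoid. *)

Section FreeAlgebra.
Variable k : fieldType.

Definition free_alg := {malg k[{fmonom gen}]}.
HB.instance Definition _ := GRing.Lalgebra.on free_alg.

Definition free_gen (u : gen) : free_alg := << fmu u >>.

Lemma free_scalerAr (c : k) (p q : free_alg) : c *: (p * q) = p * (c *: q).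
Proof.
rewrite (malgME p q) (malgMEw (fsubset_refl _) (msuppZ_le _ _)) scaler_sumr.
apply: eq_bigr => m1 _; rewrite scaler_sumr; apply: eq_bigr => m2 _.
rewrite mcoeffZ [in RHS]mulrCA; apply/malgP=> m.
by rewrite mcoeffZ !mcoeffU mulrnAr.
Qed.
HB.instance Definition _ :=
  GRing.Lalgebra_isAlgebra.Build k free_alg free_scalerAr.

Variables (A : algType k) (f : gen -> A).

Definition word_eval (m : {fmonom gen}) : A := \prod_(u <- (m : seq gen)) f u.

Lemma word_eval_mmorphism : mmorphism word_eval.
Proof.
split=> [m n|]; rewrite /word_eval.
  by rewrite -[mmul m n]/(fmmul m n) fmmulE big_cat.
by rewrite fm1 big_nil.
Qed.
HB.instance Definition _ := isMultiplicative.Build _ _ word_eval word_eval_mmorphism.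

Definition free_eval (p : free_alg) : A := mmap (in_alg A) word_eval p.

Lemma free_eval_is_zmod : zmod_morphism free_eval.
Proof. exact: raddfB. Qed.
HB.instance Definition _ :=
  GRing.isZmodMorphism.Build free_alg A free_eval free_eval_is_zmod.

Lemma free_eval_is_monoid : monoid_morphism free_eval.
Proof.
have [] := @commr_mmap_is_multiplicative _ _ _ (in_alg A) word_eval.
  by move=> p m n; rewrite /GRing.comm /= -scalerAl -scalerAr mul1r mulr1.
by move=> fM f1; split.
Qed.
HB.instance Definition _ :=
  GRing.isMonoidMorphism.Build free_alg A free_eval free_eval_is_monoid.

Lemma free_eval_is_scalable : scalable free_eval.
Proof. by move=> c p; rewrite /free_eval mmapZ /= -scalerAl mul1r. Qed.
HB.instance Definition _ :=
  GRing.isScalable.Build k free_alg A *:%R free_eval free_eval_is_scalable.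

Lemma free_eval_gen u : free_eval (free_gen u) = f u.
Proof.
by rewrite /free_eval mmapU /= scale1r mul1r /word_eval fmuE /= big_seq1.
Qed.

End FreeAlgebra.

(* D is the quotient of the free algebra by the two-sided ideal generated
   by the relations. *)

Section AlgebraD.
Variables (k : fieldType) (xi sqrt2 : k).
Local Notation F := (free_alg k).
Local Notation rels := (D_relations xi sqrt2 (@free_gen k)).

Inductive in_D_ideal : F -> Prop :=
| D_ideal_rel p r q : r \in rels -> in_D_ideal (p * r * q)
| D_ideal0 : in_D_ideal 0
| D_idealD p q : in_D_ideal p -> in_D_ideal q -> in_D_ideal (p + q).

Definition D_ideal : {pred F} :=
  fun p => if excluded_middle_informative (in_D_ideal p) then true else false.

Lemma D_idealP p : reflect (in_D_ideal p) (p \in D_ideal).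
Proof.
by rewrite unfold_in /D_ideal; case: excluded_middle_informative; constructor.
Qed.

Lemma in_D_idealMl s p : in_D_ideal p -> in_D_ideal (s * p).
Proof.
elim=> [u r v rP||u v _ IHu _ IHv].
- by rewrite !mulrA; constructor.
- by rewrite mulr0; constructor.
- by rewrite mulrDr; constructor.
Qed.

Lemma in_D_idealMr s p : in_D_ideal p -> in_D_ideal (p * s).
Proof.
elim=> [u r v rP||u v _ IHu _ IHv].
- by rewrite -(mulrA (u * r)); constructor.
- by rewrite mul0r; constructor.
- by rewrite mulrDl; constructor.
Qed.

Lemma D_ideal_zmod_closed : zmod_closed D_ideal.
Proof.
split=> [|p q /D_idealP pI /D_idealP qI]; apply/D_idealP; first by constructor.
by apply: D_idealD => //; rewrite -mulN1r; apply: in_D_idealMl.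
Qed.
HB.instance Definition _ := GRing.isZmodClosed.Build F D_ideal D_ideal_zmod_closed.

Lemma D_idealMl s p : p \in D_ideal -> s * p \in D_ideal.
Proof. by move=> /D_idealP pI; apply/D_idealP/in_D_idealMl. Qed.

Lemma D_idealMr s p : p \in D_ideal -> p * s \in D_ideal.
Proof. by move=> /D_idealP pI; apply/D_idealP/in_D_idealMr. Qed.

Lemma free_eval_ideal (A : algType k) (f : gen -> A) p :
  satisfies_D_relations xi sqrt2 f -> p \in D_ideal -> free_eval f p = 0.
Proof.
move=> fP /D_idealP; elim=> [u r v rP||u v _ IHu _ IHv].
- rewrite !rmorphM /= [free_eval f r]fP ?mulr0 ?mul0r //.
  suff -> : D_relations xi sqrt2 f = map (free_eval f) rels by apply: map_f.
  rewrite D_relations_map; apply: eq_D_relations => u' /=.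
  by rewrite free_eval_gen.
- by rewrite rmorph0.
- by rewrite rmorphD /= IHu IHv addr0.
Qed.

Lemma D_ideal_proper : 1 \notin D_ideal.
Proof.
pose f (u : gen) : k^o := match u with Ga | Gd | Gg => 1 | _ => 0 end.
have fP : satisfies_D_relations xi sqrt2 f.
  move=> r rI; apply/eqP; move: r rI; apply/allP; rewrite /= !expr1n.
  by rewrite !(mulr0, mul0r, mulr1, subrr, addr0, scaler0, expr0n, eqxx).
apply/negP => /(free_eval_ideal fP)/eqP.
by rewrite rmorph1 oner_eq0.
Qed.

Definition D_alg : Type := Quotient.quot D_ideal.
HB.instance Definition _ := GRing.Zmodule.on D_alg.
HB.instance Definition _ := EqQuotient.on D_alg.

Definition D_pi (p : F) : D_alg := \pi_D_alg p.

Lemma D_pi_eq p q : (D_pi p = D_pi q) <-> (p - q \in D_ideal).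
Proof. by rewrite Quotient.idealrBE; split=> [/eqP|/eqP]. Qed.

Lemma D_repr_pi p : repr (D_pi p) - p \in D_ideal.
Proof. by apply/D_pi_eq; rewrite /D_pi reprK. Qed.

Lemma D_piK u : D_pi (repr u) = u. Proof. exact: reprK. Qed.

Lemma D_pi_is_zmod : zmod_morphism D_pi.
Proof. by move=> p q; rewrite /D_pi !piE. Qed.
HB.instance Definition _ := GRing.isZmodMorphism.Build F D_alg D_pi D_pi_is_zmod.

Definition D_one : D_alg := D_pi 1.
Definition D_mul (u v : D_alg) : D_alg := D_pi (repr u * repr v).
Definition D_scale (c : k) (u : D_alg) : D_alg := D_pi (c *: repr u).

Lemma D_pi_mul p q : D_mul (D_pi p) (D_pi q) = D_pi (p * q).
Proof.
apply/D_pi_eq; move: (repr _) (D_repr_pi p) => p' pI.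
move: (repr _) (D_repr_pi q) => q' qI.
have -> : p' * q' - p * q = (p' - p) * q' + p * (q' - q).
  by rewrite mulrBl mulrBr addrA subrK.
by apply: rpredD; [apply: D_idealMr|apply: D_idealMl].
Qed.

Lemma D_pi_scale c p : D_scale c (D_pi p) = D_pi (c *: p).
Proof.
apply/D_pi_eq; rewrite -scalerBr -[_ - p]mul1r scalerAl.
by apply: D_idealMl; apply: D_repr_pi.
Qed.

Lemma D_mulA : associative D_mul.
Proof.
by move=> u v w; rewrite -(D_piK u) -(D_piK v) -(D_piK w) !D_pi_mul mulrA.
Qed.
Lemma D_mul1l : left_id D_one D_mul.
Proof. by move=> u; rewrite -(D_piK u) D_pi_mul mul1r. Qed.
Lemma D_mul1r : right_id D_one D_mul.
Proof. by move=> u; rewrite -(D_piK u) D_pi_mul mulr1. Qed.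
Lemma D_mulDl : left_distributive D_mul +%R.
Proof.
move=> u v w; rewrite -(D_piK u) -(D_piK v) -(D_piK w).
by rewrite -raddfD !D_pi_mul -raddfD mulrDl.
Qed.
Lemma D_mulDr : right_distributive D_mul +%R.
Proof.
move=> u v w; rewrite -(D_piK u) -(D_piK v) -(D_piK w).
by rewrite -raddfD !D_pi_mul -raddfD mulrDr.
Qed.
Lemma D_one_neq0 : D_one != 0.
Proof.
apply/eqP; rewrite -(raddf0 D_pi) => /D_pi_eq.
by rewrite subr0; apply/negP/D_ideal_proper.
Qed.
HB.instance Definition _ := GRing.Zmodule_isNzRing.Build D_alg
  D_mulA D_mul1l D_mul1r D_mulDl D_mulDr D_one_neq0.

Lemma D_scalerA c e u : D_scale c (D_scale e u) = D_scale (c * e) u.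
Proof. by rewrite -(D_piK u) !D_pi_scale scalerA. Qed.
Lemma D_scale1r : left_id 1 D_scale.
Proof. by move=> u; rewrite -(D_piK u) D_pi_scale scale1r. Qed.
Lemma D_scalerDr : right_distributive D_scale +%R.
Proof.
move=> c u v; rewrite -(D_piK u) -(D_piK v).
by rewrite -raddfD !D_pi_scale -raddfD scalerDr.
Qed.
Lemma D_scalerDl u : {morph D_scale^~ u : c e / c + e}.
Proof. by move=> c e; rewrite -(D_piK u) !D_pi_scale -raddfD scalerDl. Qed.
HB.instance Definition _ := GRing.Zmodule_isLmodule.Build k D_alg
  D_scalerA D_scale1r D_scalerDr D_scalerDl.

Lemma D_scalerAl c (u v : D_alg) : c *: (u * v) = c *: u * v.
Proof.
rewrite -(D_piK u) -(D_piK v) /GRing.mul /GRing.scale /=.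
by rewrite !(D_pi_mul, D_pi_scale) scalerAl.
Qed.
HB.instance Definition _ := GRing.Lmodule_isLalgebra.Build k D_alg D_scalerAl.

Lemma D_scalerAr c (u v : D_alg) : c *: (u * v) = u * (c *: v).
Proof.
rewrite -(D_piK u) -(D_piK v) /GRing.mul /GRing.scale /=.
by rewrite !(D_pi_mul, D_pi_scale) scalerAr.
Qed.
HB.instance Definition _ := GRing.Lalgebra_isAlgebra.Build k D_alg D_scalerAr.

Lemma D_pi_is_monoid : monoid_morphism D_pi.
Proof.
split=> [|p q]; first exact: erefl.
exact: esym (D_pi_mul p q).
Qed.
HB.instance Definition _ :=
  GRing.isMonoidMorphism.Build F D_alg D_pi D_pi_is_monoid.

Lemma D_pi_is_scalable : scalable D_pi.
Proof. by move=> c p; rewrite -D_pi_scale. Qed.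
HB.instance Definition _ :=
  GRing.isScalable.Build k F D_alg *:%R D_pi D_pi_is_scalable.

Definition D_gen (u : gen) : D_alg := D_pi (free_gen k u).

Lemma D_gen_relations : satisfies_D_relations xi sqrt2 D_gen.
Proof.
move=> r; rewrite -[D_gen]/(D_pi \o @free_gen k) -D_relations_map.
case/mapP=> p pR ->; rewrite -(rmorph0 D_pi); apply/D_pi_eq.
rewrite subr0 -[p]mul1r -[1 * p]mulr1.
by apply/D_idealP; constructor.
Qed.

(* The algebra morphism D -> A that sends each generator u to f u. *)
Section Lift.
Variables (A : algType k) (f : gen -> A).
Hypothesis fP : satisfies_D_relations xi sqrt2 f.

Definition D_lift of satisfies_D_relations xi sqrt2 f :=
  fun u : D_alg => free_eval f (repr u).

Lemma D_lift_pi p : D_lift fP (D_pi p) = free_eval f p.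
Proof.
apply/eqP; rewrite -subr_eq0 -raddfB; apply/eqP.
exact/(free_eval_ideal fP)/D_repr_pi.
Qed.

Lemma D_lift_is_zmod : zmod_morphism (D_lift fP).
Proof.
move=> u v; rewrite -(D_piK u) -(D_piK v).
by rewrite -raddfB !D_lift_pi raddfB.
Qed.
HB.instance Definition _ :=
  GRing.isZmodMorphism.Build D_alg A (D_lift fP) D_lift_is_zmod.

Lemma D_lift_is_monoid : monoid_morphism (D_lift fP).
Proof.
split=> [|u v]; first by rewrite -(rmorph1 D_pi) D_lift_pi rmorph1.
by rewrite -(D_piK u) -(D_piK v) -rmorphM !D_lift_pi rmorphM.
Qed.
HB.instance Definition _ :=
  GRing.isMonoidMorphism.Build D_alg A (D_lift fP) D_lift_is_monoid.

Lemma D_lift_is_scalable : scalable (D_lift fP).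
Proof.
by move=> c u; rewrite -(D_piK u) -linearZ !D_lift_pi linearZ.
Qed.
HB.instance Definition _ :=
  GRing.isScalable.Build k D_alg A *:%R (D_lift fP) D_lift_is_scalable.

Lemma D_lift_gen u : D_lift fP (D_gen u) = f u.
Proof. by rewrite D_lift_pi free_eval_gen. Qed.

End Lift.
End AlgebraD.

(* The left A-module of column vectors on which A acts through rho. *)
Definition rep_module (k : fieldType) (A : algType k) (n : nat)
  (rho : {lrmorphism A -> 'M[k]_n.+1}) : Type := 'cV[k]_n.+1.

Section RepModule.
Variables (k : fieldType) (A : algType k) (n : nat).
Variable rho : {lrmorphism A -> 'M[k]_n.+1}.

HB.instance Definition _ := GRing.Zmodule.on (rep_module rho).

Definition rep_act (u : A) (v : rep_module rho) : rep_module rho :=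
  rho u *m (v : 'cV[k]_n.+1).

Lemma rep_actA u w v : rep_act u (rep_act w v) = rep_act (u * w) v.
Proof. by rewrite /rep_act rmorphM mulmxA. Qed.
Lemma rep_act1 : left_id 1 rep_act.
Proof. by move=> v; rewrite /rep_act rmorph1 mul1mx. Qed.
Lemma rep_actDr : right_distributive rep_act +%R.
Proof. by move=> u v w; rewrite /rep_act; apply: mulmxDr. Qed.
Lemma rep_actDl v : {morph rep_act^~ v : u w / u + w}.
Proof. by move=> u w; rewrite /rep_act rmorphD; apply: mulmxDl. Qed.
HB.instance Definition _ := GRing.Zmodule_isLmodule.Build A (rep_module rho)
  rep_actA rep_act1 rep_actDr rep_actDl.

Lemma rep_moduleE (u : A) (v : rep_module rho) :
  u *: v = rho u *m (v : 'cV[k]_n.+1).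
Proof. by []. Qed.

End RepModule.

Definition mod_iso (A : pzRingType) (V W : lmodType A) : Prop :=
  exists h : {linear V -> W}, bijective h.

Definition simple_mod (A : pzRingType) (V : lmodType A) : Prop :=
  (exists v : V, v != 0) /\
  forall S : {pred V}, submod_closed S -> S =i pred1 0 \/ S =i predT.

(* V has dimension n over k, where k acts on V through k -> A, c |-> c%:A. *)
Definition has_kdim (k : fieldType) (A : algType k) (V : lmodType A) (n : nat) :
    Prop :=
  exists2 h : 'cV[k]_n -> V, bijective h &
    forall (c : k) (u v : 'cV[k]_n), h (c *: u + v) = c%:A *: h u + h v.

(* The action of the generators on the one-dimensional modules and on V_(i,j);
   exponents of xi are natural numbers, read mod 4 since xi ^+ 4 = 1. *)
Section SimpleModules.
Variables (k : fieldType) (xi sqrt2 : k).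
Hypotheses (xiP : 4.-primitive_root xi) (sqrt2P : sqrt2 ^+ 2 = 2).

Definition chi_mx (j : 'I_4) (u : gen) : 'M[k]_1 :=
  match u with
  | Ga => (xi ^+ j)%:M
  | Gb => 0
  | Gc => 0
  | Gd => (xi ^- j)%:M
  | Gx => 0
  | Gg => ((-1) ^+ j)%:M
  end.

Definition mx2 (p q r s : k) : 'M[k]_2 :=
  \matrix_(i < 2, j < 2) nth 0 (nth [::] [:: [:: p; q]; [:: r; s]] i) j.

Definition V_mx (i j : 'Z_4) (u : gen) : 'M[k]_2 :=
  match u with
  | Ga => mx2 (xi ^+ i) 0
              0         (xi ^+ (i + 3))
  | Gb => mx2 0 ((-1) ^+ i)
              0 0
  | Gc => mx2 0 1
              0 0
  | Gd => mx2 (xi ^- i) 0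
              0         (xi ^- i * xi)
  | Gx => mx2 0 (sqrt2 / 2 * xi * (xi ^+ i + xi ^+ (3 * i + j)))
              (sqrt2 * xi * (xi ^+ (3 * i) - xi ^+ (i + j))) 0
  | Gg => mx2 (xi ^+ j) 0
              0         (xi ^+ (j + 2))
  end.

Lemma mx2D p q r s p' q' r' s' :
  mx2 p q r s + mx2 p' q' r' s' = mx2 (p + p') (q + q') (r + r') (s + s').
Proof.
by apply/matrixP=> [[[|[|//]] ?] [[|[|//]] ?]]; rewrite !mxE.
Qed.

Lemma mx2N p q r s : - mx2 p q r s = mx2 (- p) (- q) (- r) (- s).
Proof.
by apply/matrixP=> [[[|[|//]] ?] [[|[|//]] ?]]; rewrite !mxE.
Qed.

Lemma mx2Z c p q r s : c *: mx2 p q r s = mx2 (c * p) (c * q) (c * r) (c * s).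
Proof.
by apply/matrixP=> [[[|[|//]] ?] [[|[|//]] ?]]; rewrite !mxE.
Qed.

Lemma mx2M p q r s p' q' r' s' :
  mx2 p q r s * mx2 p' q' r' s' =
  mx2 (p * p' + q * r') (p * q' + q * s') (r * p' + s * r') (r * q' + s * s').
Proof.
by apply/matrixP=> [[[|[|//]] ?] [[|[|//]] ?]];
  rewrite !mxE !big_ord_recl big_ord0 !mxE /= addr0.
Qed.

Lemma mx2_1 : 1 = mx2 1 0 0 1.
Proof.
by apply/matrixP=> [[[|[|//]] ?] [[|[|//]] ?]]; rewrite !mxE.
Qed.

Lemma mx2_eq0 p q r s : p = 0 -> q = 0 -> r = 0 -> s = 0 -> mx2 p q r s = 0.
Proof.
move=> -> -> -> ->.
by apply/matrixP=> [[[|[|//]] ?] [[|[|//]] ?]]; rewrite !mxE.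
Qed.

Lemma xi4 : xi ^+ 4 = 1. Proof. exact: prim_expr_order xiP. Qed.

Lemma xi2 : xi ^+ 2 = -1.
Proof.
have /eqP : (xi ^+ 2) ^+ 2 = 1 by rewrite -exprM xi4.
rewrite sqrf_eq1 => /orP[/eqP xi2_1|/eqP //].
by have := prim_order_dvd xiP 2; rewrite xi2_1 eqxx.
Qed.

Lemma two_neq0 : 2 != 0 :> k.
Proof.
apply/eqP=> two0; have := prim_order_dvd xiP 2; rewrite xi2 eq_sym.
by rewrite -subr_eq0 opprK -mulr2n two0 eqxx.
Qed.

Lemma expr_ord4 n : (xi ^+ n) ^+ 4 = 1.
Proof. by rewrite exprAC xi4 expr1n. Qed.

Lemma xiVn n : xi ^- n = (xi ^+ n) ^+ 3.
Proof.
have xn4 := expr_ord4 n.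
have xn0 : xi ^+ n != 0.
  apply/eqP=> x0; move: xn4; rewrite x0 expr0n /= => /eqP.
  by rewrite eq_sym oner_eq0.
by apply: (mulfI xn0); rewrite divff // -exprS xn4.
Qed.

Lemma sgn_xi n : (-1) ^+ n = (xi ^+ n) ^+ 2.
Proof. by rewrite -xi2 exprAC. Qed.

Lemma chi_relations j : satisfies_D_relations xi sqrt2 (chi_mx j).
Proof.
move=> r rI; apply/eqP; move: r rI; apply/allP.
rewrite /= xiVn sgn_xi; move: (expr_ord4 j); set p := xi ^+ j => p4.
rewrite !(mulr0, mul0r, scaler0, addr0, subr0, expr0n, eqxx, oppr0) /=.
repeat (apply/andP; split) => //; apply/eqP.
all: rewrite -?[1](rmorph1 (scalar_mx)) -?rmorphXn /= -?rmorphM /= -?rmorphB /=.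
all: rewrite ?scale_scalar_mx ?sub0r -?rmorphN /=.
all: rewrite -[RHS](rmorph0 scalar_mx); congr (_ %:M).
all: try ring: p4.
Qed.

Lemma V_relations i j : satisfies_D_relations xi sqrt2 (V_mx i j).
Proof.
have t2 : 2 * (sqrt2 / 2) ^+ 2 = 1.
  by rewrite expr2 mulrA [2 * _]mulrC divfK ?two_neq0 // mulrA -expr2 sqrt2P divff ?two_neq0.
have s2 : sqrt2 = 2 * (sqrt2 / 2) by rewrite mulrC divfK ?two_neq0.
have xi2 := xi2.
move=> r rI; apply/eqP; move: r rI; apply/allP.
rewrite /= xiVn sgn_xi; move: (expr_ord4 i) (expr_ord4 j).
rewrite [(3 * i)%N]mulnC !(exprD, exprM).
move: (sqrt2 / 2) t2 s2 => t t2 ->.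
set p := xi ^+ i; set q := xi ^+ j => p4 q4.
rewrite !(exprSr _ 1, exprSr _ 2, exprSr _ 3, expr1).
repeat (apply/andP; split) => //; apply/eqP.
all: rewrite ?mx2_1 !(mx2M, mx2Z, mx2N, mx2D).
all: apply: mx2_eq0; try ring: p4 q4 xi2.
all: transitivity ((2 * t ^+ 2 - 1) * (xi ^+ 2 * (p + p ^+ 3 * q) * (p ^+ 3 - p * q)));
  first by ring: p4 q4 xi2.
all: by rewrite t2 subrr mul0r.
Qed.

Definition chi_mod (j : 'I_4) : lmodType (D_alg xi sqrt2) :=
  rep_module (D_lift (@chi_relations j)).

Definition V_mod (i j : 'Z_4) : lmodType (D_alg xi sqrt2) :=
  rep_module (D_lift (@V_relations i j)).

Lemma chi_modE j u (v : 'cV[k]_1) :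
  D_gen xi sqrt2 u *: (v : chi_mod j) = chi_mx j u *m v.
Proof. by rewrite rep_moduleE /= D_lift_gen. Qed.

Lemma V_modE i j u (v : 'cV[k]_2) :
  D_gen xi sqrt2 u *: (v : V_mod i j) = V_mx i j u *m v.
Proof. by rewrite rep_moduleE /= D_lift_gen. Qed.

Definition Lambda := {ij : 'Z_4 * 'Z_4 | ij.1 *+ 2 != ij.2}.

Definition simple_index := ('I_4 + Lambda)%type.

Definition simple_family (t : simple_index) : lmodType (D_alg xi sqrt2) :=
  match t with
  | inl j => chi_mod j
  | inr ij => V_mod (val ij).1 (val ij).2
  end.

End SimpleModules.

(* Main.v *)
From HB Require Import structures.
From Stdlib Require Import ClassicalEpsilon.
Require Import Defs.
From mathcomp Require Import all_boot all_order all_algebra.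
From mathcomp Require Import ring monalg.

Import GRing.Theory.
Local Open Scope ring_scope.

(** The proof is a highest-weight argument in which c is the raising operator
and x the lowering one. Since c is nilpotent and commutes with a and g up to
scalars, and a^4 = g^4 = 1, every nonzero D-module contains a highest weight
vector: a nonzero v with c v = 0, a v = xi^i v and g v = xi^j v for some
weight (i, j) in Z_4 x Z_4 ([highest_weight_exists]).

Commuting the generators past x gives
  a (x v) = - xi^(i+1) x v,   g (x v) = - xi^j x v,
  c (x v) = sqrt2 xi (xi^(3i) - xi^(i+j)) v,   x (x v) = (xi^(2j) - 1) v,
so that v and x v span a submodule. The coefficient of c (x v) is zero exactly
when 2i = j ([cx_coef_eq0]). If 2i <> j, the four equations say that v and a
multiple of x v transform as the basis of V_(i,j), which gives a nonzero
morphism from V_(i,j) ([hom_of_V_mx]). If 2i = j, then either x v = 0 and v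
spans a copy of a one-dimensional module, or x v is itself a highest weight
vector that x kills ([highest_weight_double]), and the module again receives
a nonzero morphism from some k_(chi^l) ([hom_of_chi_mx]). As these source
modules are simple, Schur's lemma ([schur]) turns the morphism into an
isomorphism when the target is simple.

Conversely each module of the list has a single highest weight, namely (i, j)
for V_(i,j) and (l, 2l) for k_(chi^l). So the sixteen simple modules are in
bijection with the sixteen weights in Z_4 x Z_4: this proves both that they
are pairwise non-isomorphic and that there are 16 of them, 12 = 16 - 4 being
of dimension 2.

The argument sees D only through generators and relations, so it is stated for
any algebra A generated by elements that satisfy the relations of D. *)

(** * Simple modules and Schur's lemma *)

Section Modules.
Variable A : pzRingType.

(** A submodule contains all that can be reached from one of its elements, so
it is the whole module once it has a nonzero element. *)
Lemma cyclic_simple (V : lmodType A) :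
  (exists v : V, v != 0) ->
  (forall u v : V, u != 0 -> exists r : A, v = r *: u) -> simple_mod V.
Proof.
move=> Vn0 cyc; split=> // S [S0 Sl].
have SZ r u : u \in S -> r *: u \in S by move=> uS; rewrite -[_ *: u]addr0 Sl.
case: (excluded_middle_informative (exists2 u : V, u \in S & u != 0)).
  by move=> [u uS u0]; right=> v; have [r ->] := cyc u v u0; rewrite SZ.
move=> nS; left=> u; rewrite !inE; apply/idP/eqP=> [uS|-> //].
by apply/eqP/negP=> u0; apply: nS; exists u => //; apply/negP.
Qed.

(** Kernel and image of [f] are submodules, and the vector [w] excludes that
the first is everything or the second is zero. *)
Lemma schur (V W : lmodType A) (f : {linear W -> V}) (w : W) :
  simple_mod V -> simple_mod W -> f w != 0 -> mod_iso V W.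
Proof.
move=> [_ Vs] [_ Ws] fw0.
have [|kf|kf] := Ws [pred u | f u == 0].
- split=> [|r u v]; rewrite !inE ?raddf0 // => /eqP fu /eqP fv.
  by rewrite linearP fu fv scaler0 addr0.
- pose im (v : V) : bool := excluded_middle_informative (exists u, f u = v).
  have imP v : reflect (exists u, f u = v) (im v).
    by rewrite /im; case: excluded_middle_informative => H; constructor.
  have [|imf|imf] := Vs im.
  + split=> [|r _ _ /imP[u <-] /imP[v <-]]; apply/imP.
      by exists 0; rewrite raddf0.
    by exists (r *: u + v); rewrite linearP.
  + by have := imf (f w); rewrite inE (negPf fw0) => /imP[]; exists w.
  have sf v : exists u, f u == v.
    have /imP[u <-] : v \in im by rewrite imf.
    by exists u.
  pose g v := xchoose (sf v).
  have gK : cancel g f by move=> v; apply/eqP/(xchooseP (sf v)).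
  have fK : cancel f g.
    move=> u; apply/eqP; rewrite -subr_eq0.
    by have := kf (g (f u) - u); rewrite !inE raddfB /= gK subrr eqxx => <-.
  pose gl := GRing.isLinear.Build A V W *:%R g (can2_linear fK gK).
  pose h : {linear V -> W} := HB.pack g gl.
  by exists h; exists f.
by have := kf w; rewrite !inE (negPf fw0).
Qed.

End Modules.

(** * Consequences of the defining relations *)

Section Relations.
Context {k : fieldType} {xi sqrt2 : k} {A : algType k} {f : gen -> A}.
Hypothesis fP : satisfies_D_relations xi sqrt2 f.

Lemma D_relation_nth n : nth 0 (D_relations xi sqrt2 f) n = 0.
Proof.
have [nlt|] := ltnP n (size (D_relations xi sqrt2 f)).
  exact/fP/mem_nth.
exact: nth_default.
Qed.

Lemma gen_b : f Gb = f Ga ^+ 2 * f Gc.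
Proof. by have /eqP := D_relation_nth 10; rewrite subr_eq0 => /eqP/= ->. Qed.

Lemma gen_a4 : f Ga ^+ 4 = 1.
Proof. by have /eqP := D_relation_nth 11; rewrite subr_eq0 => /eqP. Qed.

Lemma gen_g4 : f Gg ^+ 4 = 1.
Proof. by have /eqP := D_relation_nth 12; rewrite subr_eq0 => /eqP. Qed.

Lemma gen_d : f Gd = f Ga ^+ 3.
Proof.
have /eqP := D_relation_nth 7; rewrite subr_eq0 => /eqP/= ad.
by rewrite -[RHS]mulr1 -ad mulrA -exprSr gen_a4 mul1r.
Qed.

End Relations.

(** * Generation by a, c, x and g *)

(** Generation of [A] as a k-algebra by the values of [f] on [s], in the form
of an induction principle: this is how it is applied when the equivariance of
a linear map is reduced to generators. *)
Definition alg_generated {k : fieldType} {A : algType k}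
    (f : gen -> A) (s : seq gen) : Prop :=
  forall P : A -> Prop,
    (forall c : k, P c%:A) ->
    (forall r t, P r -> P t -> P (r + t)) ->
    (forall r t, P r -> P t -> P (r * t)) ->
    {in s, forall u, P (f u)} -> forall r, P r.

Section Generation.
Context {k : fieldType}.

Local Notation gens := [:: Ga; Gb; Gc; Gd; Gx; Gg].

Lemma alg_generated_map {A B : algType k} (h : {lrmorphism A -> B}) f s :
  (forall r : B, exists p, h p = r) ->
  alg_generated f s -> alg_generated (h \o f) s.
Proof.
move=> surj fgen P Pk PD PM Ps r; have [p <-] := surj r.
apply: (fgen (P \o h)) => [c|p1 p2|p1 p2|u su] /=.
- by rewrite linearZZ rmorph1; apply: Pk.
- by rewrite rmorphD; apply: PD.
- by rewrite rmorphM; apply: PM.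
- exact: Ps.
Qed.

(** The relations give b = a^2 c and d = a^3, so that equivariance of a map
need only be checked on four generators. *)
Lemma alg_generated_acxg {xi sqrt2 : k} {A : algType k} {f : gen -> A} :
  satisfies_D_relations xi sqrt2 f ->
  alg_generated f gens -> alg_generated f [:: Ga; Gc; Gx; Gg].
Proof.
move=> fP fgen P Pk PD PM Ps.
have PX r n : P r -> P (r ^+ n).
  move=> Pr; elim: n => [|n IH]; first by rewrite expr0 -[1]scale1r.
  by rewrite exprS; apply: PM.
have [Pa Pc] : P (f Ga) /\ P (f Gc) by split; apply: Ps.
apply: fgen => // -[] _; try exact: Ps.
  by rewrite (gen_b fP); apply: PM => //; apply: PX.
by rewrite (gen_d fP); apply: PX.
Qed.

(** Every element of the monoid algebra is a combination of words, and a word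
is a product of letters. *)
Lemma free_alg_generated : alg_generated (@free_gen k) gens.
Proof.
move=> P Pk PD PM Pgen p.
have Pf u : P (free_gen k u) by apply/Pgen; case: u.
rewrite [p]monalgE; elim/big_rec: _ => [|m q _ Pq].
  by rewrite -[0](scale0r 1).
apply: PD => //.
have -> : << p@_m *g m >> = (p@_m)%:A * << m >> :> free_alg k.
  rewrite mulr_algl; apply/malgP=> m'.
  by rewrite mcoeffZ !mcoeffU mulrnAr mulr1.
apply: (PM) => //; case: m => s; elim: s => [|u s IH].
  have -> : FMonom [::] = mone :> {fmonom gen} by apply/eqP; rewrite fmP fm1.
  by rewrite -[<< _ >>]/(1 : free_alg k) -[1]scale1r.
suff -> : << FMonom (u :: s) >> = free_gen k u * << FMonom s >> :> free_alg k.
  exact: PM.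
rewrite /free_gen /GRing.mul /= fgmulUU mulr1; congr << _ >>.
by apply/eqP; rewrite fmP fmM fmuE.
Qed.

Lemma D_alg_generated (xi sqrt2 : k) : alg_generated (D_gen xi sqrt2) gens.
Proof.
apply: (alg_generated_map (@D_pi k xi sqrt2) _ _ _ free_alg_generated).
by move=> r; exists (repr r); apply: D_piK.
Qed.

End Generation.

(** * Modules over a k-algebra *)

(** The action of k on an A-module V through k -> A, for which V carries no
separate k-module structure. *)
Local Notation "c *k: v" := (c%:A *: v) (at level 40, left associativity).

Section ScalarAction.
Context {k : fieldType} {A : algType k} {V : lmodType A}.
Implicit Types (c e : k) (r : A) (v : V).

Lemma kscaleA c e v : c *k: (e *k: v) = (c * e) *k: v.
Proof. by rewrite scalerA mulr_algl scalerA. Qed.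

Lemma kscaleC c r v : r *: (c *k: v) = c *k: (r *: v).
Proof. by rewrite !scalerA mulr_algr mulr_algl. Qed.

Lemma kscaleAl c r v : (c *: r) *: v = c *k: (r *: v).
Proof. by rewrite scalerA mulr_algl. Qed.

Lemma kscale1 v : 1 *k: v = v.
Proof. by rewrite scale1r scale1r. Qed.

Lemma kscaleDl c e v : (c + e) *k: v = c *k: v + e *k: v.
Proof. by rewrite scalerDl scalerDl. Qed.

Lemma kscaleN c v : (- c) *k: v = - (c *k: v).
Proof. by rewrite scaleNr scaleNr. Qed.

Lemma kscale_eq0 c v : v != 0 -> (c *k: v == 0) = (c == 0).
Proof.
move=> v0; apply/eqP/eqP=> [cv0|->]; last by rewrite !scale0r.
apply: contra_neq_eq v0 => c0.
by rewrite -[v]kscale1 -(mulVf c0) -kscaleA cv0 scaler0.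
Qed.

Lemma kscale_inj c e v : v != 0 -> c *k: v = e *k: v -> c = e.
Proof.
move=> v0 /eqP; rewrite -subr_eq0 -kscaleN -kscaleDl kscale_eq0 //.
by rewrite subr_eq0 => /eqP.
Qed.

(** If a product of the T - c kills v, then applying the factors to v one
after the other, the last vector before zero is an eigenvector. The predicate
[P] is carried along so that the eigenvector is found inside a subspace stable
under T, such as the kernel of another operator or one of its eigenspaces. *)
Lemma eigenvector_split (T : A) (P : V -> Prop) (s : seq k) v :
  (forall c w, P w -> P (T *: w - c *k: w)) -> v != 0 -> P v ->
  horner_alg T (\prod_(c <- s) ('X - c%:P)) *: v = 0 ->
  exists2 c, c \in s & exists w, [/\ w != 0, P w & T *: w = c *k: w].
Proof.
move=> Pstep; elim: s v => [|c s IH] v v0 Pv.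
  by rewrite big_nil rmorph1 scale1r => /eqP; rewrite (negPf v0).
rewrite big_cons mulrC rmorphM -scalerA rmorphB /= horner_algX horner_algC.
rewrite scalerBl; have [Tv _|Tv0] := eqVneq (T *: v - c *k: v) 0.
  exists c; first exact: mem_head.
  by exists v; split=> //; apply/eqP; rewrite -subr_eq0 Tv.
case/IH=> // [|e es Pe]; first exact: Pstep.
by exists e; rewrite // inE es orbT.
Qed.

Lemma eigenvector_unity (n : nat) (z : k) (T : A) (P : V -> Prop) v :
  n.-primitive_root z -> T ^+ n = 1 ->
  (forall c w, P w -> P (T *: w - c *k: w)) -> v != 0 -> P v ->
  exists (i : 'I_n) w, [/\ w != 0, P w & T *: w = (z ^+ i) *k: w].
Proof.
move=> zP Tn Pstep v0 Pv.
have [||_ /mapP[i + ->] [w wP]] :=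
    eigenvector_split T P [seq z ^+ i | i <- index_iota 0 n] v Pstep v0.
- by [].
- by rewrite big_map factor_Xn_sub_1 // rmorphB rmorphXn /= horner_algX rmorph1
    Tn subrr scale0r.
by rewrite mem_index_iota => /= ilt; exists (Ordinal ilt), w.
Qed.

(** A module on column vectors maps to V as soon as V has vectors on which the
generators act by the columns of the given matrices: the k-linear extension is
equivariant for the generators, hence for A. *)
Lemma rep_hom {n : nat} (f : gen -> A) (s : seq gen)
    (rho : {lrmorphism A -> 'M[k]_n.+1}) (e : 'I_n.+1 -> V) :
  alg_generated f s ->
  {in s, forall u l, f u *: e l = \sum_m rho (f u) m l *k: e m} ->
  exists h : {linear rep_module rho -> V}, forall l, h (delta_mx l 0) = e l.
Proof.
move=> fgen eP; pose h (p : rep_module rho) := \sum_l p l 0 *k: e l.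
have hD p q : h (p + q) = h p + h q.
  by rewrite -big_split; apply: eq_bigr => l _; rewrite mxE kscaleDl.
have hZ : scalable h.
  move=> r p; rewrite rep_moduleE; move: r p.
  apply: fgen => [c|r t rP tP|r t rP tP|u us] p.
  - rewrite linearZZ rmorph1 scaler_sumr -scalemxAl mul1mx.
    by apply: eq_bigr => l _; rewrite mxE kscaleA.
  - by rewrite rmorphD mulmxDl hD rP tP scalerDl.
  - by rewrite rmorphM -mulmxA rP tP scalerA.
  rewrite /h scaler_sumr.
  under [RHS]eq_bigr => m _ do rewrite kscaleC eP // scaler_sumr.
  rewrite exchange_big; apply: eq_bigr => l _ /=.
  rewrite mxE !scaler_suml; apply: eq_bigr => m _.
  by rewrite kscaleA mulrC.
have hB : zmod_morphism h.
  by move=> p q; rewrite hD -[in LHS]scaleN1r hZ scaleN1r.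
pose hl : {linear rep_module rho -> V} := HB.pack h
  (GRing.isZmodMorphism.Build _ _ h hB) (GRing.isScalable.Build _ _ _ _ h hZ).
exists hl => l; rewrite /= /h (bigD1 l) //= mxE !eqxx kscale1.
rewrite big1 ?addr0 // => m ml.
by rewrite mxE (negPf ml) !scale0r.
Qed.

End ScalarAction.

(** * Highest weight vectors *)

Definition highest_weight {k : fieldType} {A : algType k} (f : gen -> A)
    {V : lmodType A} (v : V) (al ga : k) : Prop :=
  [/\ v != 0, f Gc *: v = 0, f Ga *: v = al *k: v & f Gg *: v = ga *k: v].

Section HighestWeight.
Context {k : fieldType} {xi sqrt2 : k}.
Hypotheses (xiP : 4.-primitive_root xi) (sqrt2P : sqrt2 ^+ 2 = 2).
Context {A : algType k} {f : gen -> A}.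
Hypothesis fP : satisfies_D_relations xi sqrt2 f.
Local Notation rel n := (D_relation_nth fP n).

(** The kernel of c is nonzero since c^2 = 0, and a and g act on it because
they commute with c up to scalars; they commute with each other, so g can be
diagonalized inside an eigenspace of a. *)
Lemma highest_weight_exists (V : lmodType A) (v : V) : v != 0 ->
  exists (i j : 'Z_4) (w : V), highest_weight f w (xi ^+ i) (xi ^+ j).
Proof.
move=> v0; have [w w0 cw] : exists2 w : V, w != 0 & f Gc *: w = 0.
  have [cv|cv0] := eqVneq (f Gc *: v) 0; first by exists v.
  by exists (f Gc *: v); rewrite // scalerA -expr2 [_ ^+ 2](rel 9) scale0r.
have xi0 : xi != 0 by rewrite (prim_root_eq0 xiP).
have ca : f Gc * f Ga = xi^-1 *: (f Ga * f Gc).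
  have /eqP := rel 1; rewrite subr_eq0 => /eqP/= ->.
  by rewrite scalerA mulVf // scale1r.
have cg : f Gc * f Gg = - (f Gg * f Gc).
  by have /eqP := rel 17; rewrite addr_eq0 => /eqP.
have ag : f Ga * f Gg = f Gg * f Ga.
  by have /eqP := rel 15; rewrite subr_eq0 => /eqP.
have [|i [w1 [w10 cw1 aw1]]] :=
  eigenvector_unity 4 xi (f Ga) (fun w => f Gc *: w = 0) w
    xiP (gen_a4 fP) _ w0 cw.
  move=> c u cu; rewrite scalerBr kscaleC scalerA ca kscaleAl -scalerA cu.
  by rewrite !scaler0 subr0.
have [||j [w2 [w20 [cw2 aw2] gw2]]] := eigenvector_unity 4 xi (f Gg)
  (fun w => f Gc *: w = 0 /\ f Ga *: w = xi ^+ i *k: w) w1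
  xiP (gen_g4 fP) _ w10.
- move=> c u [cu au]; split.
    rewrite scalerBr kscaleC scalerA cg scaleNr -scalerA cu.
    by rewrite !scaler0 oppr0 addr0.
  rewrite !scalerBr scalerA ag -scalerA kscaleC au kscaleC.
  by rewrite !kscaleA [c * _]mulrC.
- by [].
by exists i, j, w2.
Qed.

(** The eigenvalue of c x on a highest weight vector of weight (al, ga). *)
Definition cx_coef (al ga : k) : k := sqrt2 * xi * (al ^+ 3 - al * ga).

Section XImage.
Context {V : lmodType A} {v : V} {al ga : k}.
Hypothesis vP : highest_weight f v al ga.

Lemma highest_weight_a_x : f Ga *: (f Gx *: v) = (- (xi * al)) *k: (f Gx *: v).
Proof.
have [_ cv av _] := vP.
have /eqP := rel 19; rewrite /= subr_eq0 => /eqP/(canRL (addrK _)) ax.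
rewrite scalerA ax (gen_b fP) scalerBl (kscaleAl (_ * _)) (kscaleAl xi).
rewrite scalerDl -(scalerA (f Gx)) -(scalerA (f Gg)) -(scalerA _ (f Gc)) cv.
by rewrite !scaler0 addr0 scaler0 sub0r av kscaleC kscaleA kscaleN.
Qed.

Lemma highest_weight_g_x : f Gg *: (f Gx *: v) = (- ga) *k: (f Gx *: v).
Proof.
have [_ _ _ gv] := vP; have /eqP := rel 14; rewrite addr_eq0 => /eqP/= gx.
by rewrite scalerA gx scaleNr -scalerA gv kscaleC kscaleN.
Qed.

Lemma highest_weight_c_x :
  f Gc *: (f Gx *: v) = cx_coef al ga *k: v.
Proof.
have [_ cv av gv] := vP.
have aX n : f Ga ^+ n *: v = (al ^+ n) *k: v.
  elim: n => [|n IH]; first by rewrite !expr0 kscale1 scale1r.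
  by rewrite exprS -scalerA IH kscaleC av kscaleA exprSr.
have /eqP := rel 21; rewrite /= subr_eq0 => /eqP/(canRL (addrK _)) cx.
rewrite scalerA cx (gen_d fP) scalerBl (kscaleAl (_ * _)) (kscaleAl xi).
rewrite scalerBl -(scalerA (f Gx)) -(scalerA (f Gg)) cv !scaler0 subr0 av aX.
by rewrite kscaleC gv kscaleA -kscaleN -kscaleDl kscaleA.
Qed.

Lemma highest_weight_x_x : f Gx *: (f Gx *: v) = (ga ^+ 2 - 1) *k: v.
Proof.
have [_ _ _ gv] := vP.
have /eqP := rel 13; rewrite /= subr_eq0 => /eqP xx.
rewrite scalerA -expr2 xx expr2 scalerBl -scalerA gv kscaleC gv kscaleA.
by rewrite scale1r kscaleDl kscaleN kscale1.
Qed.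

End XImage.

Lemma xi_val_inj : injective (fun i : 'Z_4 => xi ^+ i).
Proof.
move=> i j /eqP; rewrite (eq_prim_root_expr xiP) !modn_small //.
by move=> /eqP/val_inj.
Qed.

Lemma xi_val_double (i : 'Z_4) : xi ^+ (i *+ 2)%R = (xi ^+ i) ^+ 2.
Proof. by rewrite mulr2n /= (expr_mod _ (xi4 xiP)) exprD. Qed.

(** With al = xi^i and ga = xi^j, the coefficient is
sqrt2 xi al (al^2 - ga), which is zero exactly when xi^(2i) = xi^j. *)
Lemma cx_coef_eq0 (i j : 'Z_4) :
  (cx_coef (xi ^+ i) (xi ^+ j) == 0) = (i *+ 2 == j).
Proof.
have xi0 n : xi ^+ n != 0 by rewrite expf_neq0 // (prim_root_eq0 xiP).
have s0 : sqrt2 != 0.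
  have := two_neq0 xiP; rewrite -sqrt2P; apply: contra_neq => ->.
  by rewrite expr0n.
rewrite -(inj_eq xi_val_inj) xi_val_double /cx_coef (exprS _ 2) -mulrBr.
rewrite !mulf_eq0 (negPf s0) (negPf (xi0 i)) subr_eq0 /=.
by rewrite (negPf (xi0 1)).
Qed.

(** The basis of V_(i,j) is sent to v and x v / l, where l is the eigenvalue
of c x on v: dividing by l makes c map the second vector to the first. *)
Lemma hom_of_V_mx (V : lmodType A) (i j : 'Z_4)
    (rho : {lrmorphism A -> 'M[k]_2}) (v : V) :
  alg_generated f [:: Ga; Gb; Gc; Gd; Gx; Gg] ->
  (forall u, rho (f u) = V_mx xi sqrt2 i j u) ->
  i *+ 2 != j -> highest_weight f v (xi ^+ i) (xi ^+ j) ->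
  exists (h : {linear rep_module rho -> V}) w, h w = v.
Proof.
move=> fgen rhoE ij vP; have [_ cv av gv] := vP.
pose l := cx_coef (xi ^+ i) (xi ^+ j); have l0 : l != 0 by rewrite cx_coef_eq0.
have xi2' := xi2 xiP.
have lE : l = sqrt2 * xi * (xi ^+ (3 * i) - xi ^+ (i + j)).
  by rewrite /l /cx_coef mulnC exprM exprD.
(* The product of the two entries of x in V_(i,j) is the value of x^2 on v;
   the factor sqrt2^2 / 2 = 1 has to be isolated for the ring identity. *)
have xx : xi ^+ j ^+ 2 - 1 =
    l * (sqrt2 / 2 * xi * (xi ^+ i + xi ^+ (3 * i + j))).
  rewrite /l /cx_coef mulnC exprD exprM; move: (expr_ord4 xiP i).
  set p := xi ^+ i; set q := xi ^+ j => p4.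
  transitivity (xi ^+ 2 * ((p ^+ 3 - p * q) * (p + p ^+ 3 * q))).
    by rewrite xi2'; ring: p4.
  transitivity (sqrt2 ^+ 2 / 2 * xi ^+ 2 * 
                    ((p ^+ 3 - p * q) * (p + p ^+ 3 * q))).
    by rewrite sqrt2P divff ?(two_neq0 xiP) // mul1r.
  by ring.
pose e (m : 'I_2) := if m == 0 then v else l^-1 *k: (f Gx *: v).
have [h hE] : exists h : {linear rep_module rho -> V},
    forall m, h (delta_mx m 0) = e m.
  apply: (rep_hom f _ rho e (alg_generated_acxg fP fgen)).
  move=> u us m; rewrite rhoE !big_ord_recl big_ord0 addr0.
  case: u us => // _; case: m => [[|[|//]] ?]; rewrite !mxE /= /e /=.
  all: rewrite ?scale0r ?addr0 ?add0r //.
  - rewrite kscaleC (highest_weight_a_x vP) !kscaleA exprD exprSr xi2'.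
    by congr (_ *k: _); ring.
  - by rewrite kscaleC (highest_weight_c_x vP) kscaleA mulVf.
  - by rewrite kscaleA -lE divff // kscale1.
  - rewrite kscaleC (highest_weight_x_x vP) kscaleA; congr (_ *k: _).
    by apply: (mulfI l0); rewrite mulVKf.
  - rewrite kscaleC (highest_weight_g_x vP) !kscaleA exprD xi2'.
    by congr (_ *k: _); ring.
by exists h, (delta_mx 0 0); rewrite hE.
Qed.

End HighestWeight.

(** * The two families of modules *)

Lemma eq_col2 {R : Type} (u v : 'cV[R]_2) :
  u 0 0 = v 0 0 -> u 1 0 = v 1 0 -> u = v.
Proof.
move=> uv0 uv1; apply/matrixP=> i j; rewrite ord1.
by case: i => [[|[|//]] i2]; [move: uv0 | move: uv1];
  congr (u _ _ = v _ _); apply: val_inj.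
Qed.

Lemma mx2_mul_col {k : fieldType} (p q r s : k) (v : 'cV[k]_2) :
  ((mx2 p q r s *m v) 0 0 = p * v 0 0 + q * v 1 0) *
  ((mx2 p q r s *m v) 1 0 = r * v 0 0 + s * v 1 0).
Proof.
have l01 : lift ord0 ord0 = 1 :> 'I_2 by apply: val_inj.
by split; rewrite mxE big_ord_recl big_ord1 l01 !mxE.
Qed.

Section Families.
Context {k : fieldType} {xi sqrt2 : k}.
Hypotheses (xiP : 4.-primitive_root xi) (sqrt2P : sqrt2 ^+ 2 = 2).
Context {A : algType k} {f : gen -> A}.
Hypothesis fP : satisfies_D_relations xi sqrt2 f.
Hypothesis fgen : alg_generated f [:: Ga; Gb; Gc; Gd; Gx; Gg].

(** If x v <> 0, then x v replaces v: c kills it because the eigenvalue of c x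
is zero, and x kills it because x^2 v = (xi^(4i) - 1) v = 0. Its weight is
again of the form (l, 2l), since (- xi^(i+1))^2 = - xi^(2i). *)
Lemma highest_weight_double (V : lmodType A) (i : 'Z_4) (v : V) :
  highest_weight f v (xi ^+ i) (xi ^+ (i *+ 2)%R) ->
  exists (l : 'I_4) (w : V),
    highest_weight f w (xi ^+ l) ((-1) ^+ l) /\ f Gx *: w = 0.
Proof.
move=> vP; have [xv0|xv0] := eqVneq (f Gx *: v) 0.
  by exists i, v; rewrite (sgn_xi xiP) -(xi_val_double xiP).
have [|l lE] := prim_rootP xiP (x := - (xi * xi ^+ i)).
  by rewrite exprNn exprMn (xi4 xiP) (expr_ord4 xiP) !mulr1 -signr_odd.
exists l, (f Gx *: v); split; first split=> //.
- rewrite (highest_weight_c_x fP vP).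
  have := cx_coef_eq0 xiP sqrt2P i (i *+ 2).
  by rewrite eqxx => /eqP ->; rewrite !scale0r.
- by rewrite -lE (highest_weight_a_x fP vP).
- rewrite (highest_weight_g_x fP vP) (sgn_xi xiP) -lE (xi_val_double xiP).
  by rewrite sqrrN exprMn (xi2 xiP) mulN1r.
rewrite (highest_weight_x_x fP vP) (xi_val_double xiP) -exprM.
by rewrite (expr_ord4 xiP i) subrr !scale0r.
Qed.

Lemma hom_of_chi_mx (V : lmodType A) (j : 'I_4)
    (rho : {lrmorphism A -> 'M[k]_1}) (v : V) :
  (forall u, rho (f u) = chi_mx xi j u) ->
  highest_weight f v (xi ^+ j) ((-1) ^+ j) -> f Gx *: v = 0 ->
  exists (h : {linear rep_module rho -> V}) w, h w = v.
Proof.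
move=> rhoE [_ cv av gv] xv.
have [h hE] : exists h : {linear rep_module rho -> V},
    forall m, h (delta_mx m 0) = (fun=> v) m.
  apply: (rep_hom f _ rho (fun=> v) (alg_generated_acxg fP fgen)).
  move=> u us m; rewrite rhoE big_ord1 (ord1 m).
  by case: u us => // _; rewrite !mxE /= ?mulr1n ?scale0r.
by exists h, (delta_mx 0 0); rewrite hE.
Qed.

Lemma rep1_simple (rho : {lrmorphism A -> 'M[k]_1}) :
  simple_mod (rep_module rho).
Proof.
apply: cyclic_simple => [|u v u0].
  exists (const_mx 1); apply/eqP => /matrixP/(_ 0 0)/eqP.
  by rewrite !mxE oner_eq0.
exists (v 0 0 / u 0 0)%:A; rewrite rep_moduleE linearZZ rmorph1.
rewrite -scalemxAl mul1mx; apply/matrixP=> i j; rewrite !ord1 mxE divfK //.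
apply: contra u0 => /eqP u00; apply/eqP/matrixP=> i' j'.
by rewrite !ord1 u00 mxE.
Qed.

(** From any nonzero vector c or a scalar leads to the first basis vector,
and x leads from there to the second one, with the nonzero coefficient
[cx_coef]. *)
Lemma V_mx_simple (i j : 'Z_4) (rho : {lrmorphism A -> 'M[k]_2}) :
  (forall u, rho (f u) = V_mx xi sqrt2 i j u) -> i *+ 2 != j ->
  simple_mod (rep_module rho).
Proof.
move=> rhoE ij.
pose l := cx_coef (xi := xi) (sqrt2 := sqrt2) (xi ^+ i) (xi ^+ j).
have l0 : l != 0 by rewrite cx_coef_eq0.
have lE : sqrt2 * xi * (xi ^+ (3 * i) - xi ^+ (i + j)) = l.
  by rewrite /l /cx_coef mulnC exprM exprD.
pose e0 : rep_module rho := delta_mx 0 0.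
have kE c (v : rep_module rho) : c%:A *: v = c *: (v : 'cV[k]_2) :> 'cV_2.
  by rewrite rep_moduleE linearZZ rmorph1 -scalemxAl mul1mx.
apply: cyclic_simple => [|u v u0].
  by exists e0; apply/eqP => /matrixP/(_ 0 0)/eqP; rewrite !mxE oner_eq0.
have [r re0] : exists r, r *: u = e0.
  have [u10|u10] := eqVneq (u 1 0) 0.
    exists (u 0 0)^-1%:A; rewrite kE.
    apply: eq_col2; rewrite !mxE ?u10 ?mulr0 // mulVf //.
    apply: contra u0 => /eqP u00; apply/eqP.
    by apply: eq_col2; rewrite ?u00 ?u10 mxE.
  exists ((u 1 0)^-1%:A * f Gc); rewrite -scalerA kE rep_moduleE rhoE.
  apply: eq_col2; rewrite [LHS]mxE mx2_mul_col [RHS]mxE /=.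
    by rewrite mul0r add0r mul1r mulVf.
  by rewrite !mul0r addr0 mulr0.
exists (((v 0 0)%:A + (v 1 0 / l)%:A * f Gx) * r).
rewrite -(scalerA _ r) re0 scalerDl -(scalerA _ (f Gx)) !kE rep_moduleE rhoE.
apply: eq_col2; rewrite [RHS]mxE [in RHS]mxE [in X in _ + X]mxE;
  rewrite mx2_mul_col !mxE /=.
  by rewrite mul0r mulr0 !addr0 mulr0 addr0 mulr1.
by rewrite mulr0 add0r lE mul0r addr0 mulr1 divfK.
Qed.

(** The kernel of c on each of the modules is a line (spanned by the first basis
vector), so the module determines its highest weight. *)
Lemma highest_weight_chi_mx (j : 'I_4) (rho : {lrmorphism A -> 'M[k]_1})
    (v : rep_module rho) (al ga : k) :
  (forall u, rho (f u) = chi_mx xi j u) -> highest_weight f v al ga ->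
  al = xi ^+ j /\ ga = (-1) ^+ j.
Proof.
move=> rhoE [v0 cv av gv].
have kE c : c%:A *: v = c *: (v : 'cV[k]_1) :> 'cV_1.
  by rewrite rep_moduleE linearZZ rmorph1 -scalemxAl mul1mx.
split; apply: (kscale_inj _ _ v v0).
  by rewrite -av kE rep_moduleE rhoE mul_scalar_mx.
by rewrite -gv kE rep_moduleE rhoE mul_scalar_mx.
Qed.

Lemma highest_weight_V_mx (i j : 'Z_4) (rho : {lrmorphism A -> 'M[k]_2})
    (v : rep_module rho) (al ga : k) :
  (forall u, rho (f u) = V_mx xi sqrt2 i j u) -> highest_weight f v al ga ->
  al = xi ^+ i /\ ga = xi ^+ j.
Proof.
move=> rhoE [v0 cv av gv].
have kE c : c%:A *: v = c *: (v : 'cV[k]_2) :> 'cV_2.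
  by rewrite rep_moduleE linearZZ rmorph1 -scalemxAl mul1mx.
have v1 : v 1 0 = 0.
  have := congr1 (fun w : 'cV_2 => w 0 0) cv.
  by rewrite rep_moduleE rhoE mx2_mul_col mul0r add0r mul1r mxE.
have v00 : v 0 0 != 0.
  apply: contra v0 => /eqP v00; apply/eqP.
  by apply: eq_col2; rewrite ?v00 ?v1 mxE.
move: av gv; rewrite !kE !rep_moduleE !rhoE.
move=> /(congr1 (fun w : 'cV_2 => w 0 0)) av /(congr1 (fun w : 'cV_2 => w 0 0)).
move: av; rewrite !mx2_mul_col v1 !mulr0 !addr0 [RHS]mxE => /(mulIf v00) <-.
by rewrite mxE => /(mulIf v00) <-.
Qed.

End Families.

Lemma highest_weight_iso {k : fieldType} {A : algType k} {f : gen -> A}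
    {V W : lmodType A} {v : V} {al ga : k} :
  mod_iso V W -> highest_weight f v al ga ->
  exists w : W, highest_weight f w al ga.
Proof.
move=> [h /bij_inj hinj] [v0 cv av gv]; exists (h v).
by split; rewrite -?linearZ ?cv ?av ?gv ?raddf0 //= -(raddf0 h) (inj_eq hinj).
Qed.

(** * Simple modules and weights *)

(** The highest weight of each simple module, as a pair of exponents of xi. *)
Definition weight (t : simple_index) : 'Z_4 * 'Z_4 :=
  match t with inl j => ((j : 'Z_4), (j : 'Z_4) *+ 2) | inr ij => val ij end.

Definition of_weight (ij : 'Z_4 * 'Z_4) : simple_index :=
  if insub ij is Some l then inr l else inl ij.1.

Lemma weightK : cancel weight of_weight.
Proof.
case=> [j|l]; rewrite /of_weight /=; last by rewrite valK.
by rewrite insubF //= eqxx.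
Qed.

Lemma of_weightK : cancel of_weight weight.
Proof.
move=> ij; rewrite /of_weight; case: insubP => [l _ //|/=].
by case: ij => i j; rewrite negbK /= => /eqP ->.
Qed.

Lemma card_simple_index : #|{: simple_index}| = 16%N.
Proof.
by rewrite (bij_eq_card (Bijective weightK of_weightK)) card_prod !card_ord.
Qed.

Lemma card_Lambda : #|{: Lambda}| = 12%N.
Proof. by have := card_simple_index; rewrite card_sum card_ord => -[]. Qed.

(** * Classification *)

Section Classification.
Context {k : fieldType} {xi sqrt2 : k}.
Hypotheses (xiP : 4.-primitive_root xi) (sqrt2P : sqrt2 ^+ 2 = 2).
Local Notation simple := (simple_family xiP sqrt2P).
Local Notation hw := (highest_weight (D_gen xi sqrt2)).

Lemma highest_weight_simple_family (t : simple_index) (v : simple t) al ga :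
  hw v al ga -> al = xi ^+ (weight t).1 /\ ga = xi ^+ (weight t).2.
Proof.
case: t v => [j|l] v.
  rewrite (xi_val_double xiP) -(sgn_xi xiP).
  by apply: highest_weight_chi_mx => u; apply: D_lift_gen.
by apply: highest_weight_V_mx => u; apply: D_lift_gen.
Qed.

Lemma simple_family_simple t : simple_mod (simple t).
Proof.
case: t => [j|[[i j] ij]]; first exact: rep1_simple.
by apply: (V_mx_simple xiP sqrt2P i j _ _ ij) => u; apply: D_lift_gen.
Qed.

Lemma simple_family_inj s t : mod_iso (simple s) (simple t) -> s = t.
Proof.
move=> st; have [[v v0] _] := simple_family_simple s.
have [i [j [w wP]]] :=
  highest_weight_exists xiP (@D_gen_relations k xi sqrt2) _ v v0.
have [w' w'P] := highest_weight_iso st wP.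
have [is_ js] := highest_weight_simple_family s w _ _ wP.
have [it jt] := highest_weight_simple_family t w' _ _ w'P.
apply: (can_inj weightK); rewrite [weight s]surjective_pairing.
rewrite [weight t]surjective_pairing.
by congr (_, _); apply: (xi_val_inj xiP); rewrite -?is_ -?js.
Qed.

Lemma simple_family_complete (V : lmodType (D_alg xi sqrt2)) :
  simple_mod V -> exists t, mod_iso V (simple t).
Proof.
move=> Vs; have [[v v0] _] := Vs.
pose DP := @D_gen_relations k xi sqrt2.
have Dgen := D_alg_generated xi sqrt2.
have from_hom t (h : {linear simple t -> V}) u :
    h u != 0 -> exists t, mod_iso V (simple t).
  by move=> hu; exists t; apply: schur hu => //; apply: simple_family_simple.
have [i [j [w wP]]] := highest_weight_exists xiP DP _ v v0.
have [ij|ij] := eqVneq (i *+ 2) j.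
  rewrite -ij in wP.
  have [l [u [uP xu]]] := highest_weight_double xiP sqrt2P DP _ _ _ wP.
  have [|h [u' hu]] := hom_of_chi_mx DP Dgen _ l
    (D_lift (@chi_relations k xi sqrt2 xiP l)) u _ uP xu.
    by move=> ?; apply: D_lift_gen.
  by apply: (from_hom (inl l) h u'); rewrite hu; case: uP.
have [|h [u' hu]] := hom_of_V_mx xiP sqrt2P DP _ i j
  (D_lift (@V_relations k xi sqrt2 xiP sqrt2P i j)) w Dgen _ ij wP.
  by move=> ?; apply: D_lift_gen.
by apply: (from_hom (inr (exist _ (i, j) ij)) h u'); rewrite hu; case: wP.
Qed.

End Classification.

Lemma rep_module_kdim {k : fieldType} {A : algType k} {n : nat}
  (rho : {lrmorphism A -> 'M[k]_n.+1}) : has_kdim (rep_module rho) n.+1.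
Proof.
exists id; first exact: (Bijective (g := id)).
by move=> c u v; rewrite rep_moduleE linearZZ rmorph1 -scalemxAl mul1mx.
Qed.

Theorem theorem2p9 (k : closedFieldType) (char0 : [pchar k] =i pred0)
    (xi sqrt2 : k) (xiP : 4.-primitive_root xi) (sqrt2P : sqrt2 ^+ 2 = 2) :
  [/\ #|{: Lambda}| = 12%N,
      #|{: simple_index}| = 16%N,
      (forall j : 'I_4,
         simple_mod (chi_mod sqrt2 xiP j) /\
         has_kdim (chi_mod sqrt2 xiP j) 1),
      (forall i j : 'Z_4, i *+ 2 != j ->
         simple_mod (V_mod xiP sqrt2P i j) /\
         has_kdim (V_mod xiP sqrt2P i j) 2)
    & (forall s t : simple_index,
         mod_iso (simple_family xiP sqrt2P s) (simple_family xiP sqrt2P t) ->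
         s = t) /\
      (forall V : lmodType (D_alg xi sqrt2), simple_mod V ->
         exists t : simple_index, mod_iso V (simple_family xiP sqrt2P t))].
Proof.
split.
- exact: card_Lambda.
- exact: card_simple_index.
- move=> j; split; last exact: rep_module_kdim.
  exact: (simple_family_simple xiP sqrt2P (inl j)).
- move=> i j ij; split; last exact: rep_module_kdim.
  exact: (simple_family_simple xiP sqrt2P (inr (exist _ (i, j) ij))).
- split; first exact: simple_family_inj.
  exact: simple_family_complete.
Qed.
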